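(* Consider the online vector scheduling problem on unrelated machines with arbitrary given $L_r$-norm objectives (VSANY-U), as defined in the context. Then: (i) There is an online algorithm for VSANY-U that simultaneously, for each dimension $k\in[d]$, obtains a competitive ratio of $O(r_k+\log d)$ for the $L_{r_k}$ norm in dimension $k$; i.e., its assignment satisfies $\|\Lambda(k)\|_{r_k}\le O(r_k+\log d)\cdot T_k$ for every $k$. (ii) These ratios are tight: for every $r$ with $1\le r\le\log m$, there is a lower bound of $\Omega(r+\log d)$ on the competitive ratio of any online algorithm for VSANY-U, even when $r_k=r$ for all dimensions $k$.
   Context: Online vector scheduling on unrelated machines: a fixed set $M$ of $m$ machines, $d\ge1$ dimensions; jobs $j$ arrive online one by one, each revealing nonnegative load vectors $p_{i,j}=\langle p_{i,j}(k):k\in[d]\rangle$ for every machine $i$, and must be immediately and irrevocably assigned to a machine. An assignment $f$ yields loads $\Lambda_i(k)=\sum_{j:f(j)=i}p_{i,j}(k)$ and $\Lambda(k)=(\Lambda_i(k))_{i\in M}$. In VSANY-U the algorithm is given in advance norms $r_1,\dots,r_d$ with $1\le r_k\le\log m$ and a feasible target vector $T=\langle T_1,\dots,T_d\rangle$, where feasible means there exists an (offline) assignment with $\|\Lambda(k)\|_{r_k}=\left(\sum_{i\in M}\Lambda_i(k)^{r_k}\right)^{1/r_k}\le T_k$ for every $k$. An online algorithm is $\alpha_{r_k}$-competitive in the $L_{r_k}$ norm in dimension $k$ if its assignment satisfies $\|\Lambda(k)\|_{r_k}\le\alpha_{r_k}T_k$. *)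

(* Defs.v *)
From HB Require Import structures.
From mathcomp Require Import all_boot all_order all_algebra.
From mathcomp Require Import all_classical all_reals all_analysis.

Set Implicit Arguments.
Unset Strict Implicit.
Unset Printing Implicit Defensive.

Import Order.TTheory GRing.Theory Num.Theory.

Local Open Scope ring_scope.

(** Online vector scheduling on unrelated machines with given L_r-norm
    objectives (VSANY-U), in MathComp-Analysis. *)

(* Logarithms are taken in base 2.  For the range 1 <= r <= log m this is the
   most permissive of the usual bases; inside asymptotic bounds the base is
   absorbed by the constants. *)
Definition log2 {R : realType} (x : R) : R := ln x / ln 2.

Section VectorScheduling.
Context {R : realType} {m d : nat}.

(* [p i k] is the load in dimension [k] that the job [p] puts on machine [i]
   if it is assigned there. *)
Definition job := 'M[R]_(m, d).

Definition nonneg_job (p : job) : Prop := forall i k, 0 <= p i k.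

Section Assignment.
Variables (n : nat) (jobs : n.-tuple job) (f : 'I_n -> 'I_m).

Definition load (k : 'I_d) (i : 'I_m) : R :=
  \sum_(j < n | f j == i) tnth jobs j i k.

End Assignment.

Definition Lr_norm (r : R) (x : 'I_m -> R) : R :=
  (\sum_(i < m) x i `^ r) `^ r^-1.

Definition feasible (r T : 'I_d -> R) (n : nat) (jobs : n.-tuple job) : Prop :=
  exists f : 'I_n -> 'I_m, forall k, Lr_norm (r k) (load jobs f k) <= T k.

(* The arguments are the norms, the target vector, the jobs that arrived
   before the current one (in order of arrival) and the current job.  The total
   number of jobs is not revealed; the earlier decisions of the algorithm need
   not be passed, since they are determined by the other arguments. *)
Definition online_algorithm : Type :=
  ('I_d -> R) -> ('I_d -> R) -> seq job -> job -> 'I_m.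

Definition online_assignment (A : online_algorithm) (r T : 'I_d -> R)
    (n : nat) (jobs : n.-tuple job) (j : 'I_n) : 'I_m :=
  A r T (take j jobs) (tnth jobs j).

Definition admissible_norms (r : 'I_d -> R) : Prop :=
  forall k, 1 <= r k <= log2 m%:R.

Definition competitive (A : online_algorithm) (r alpha : 'I_d -> R) : Prop :=
  forall (T : 'I_d -> R) (n : nat) (jobs : n.-tuple job),
    (forall j, nonneg_job (tnth jobs j)) ->
    feasible r T jobs ->
    forall k, Lr_norm (r k) (load jobs (online_assignment A r T jobs) k)
              <= alpha k * T k.

End VectorScheduling.

Arguments job : clear implicits.
Arguments online_algorithm : clear implicits.
Arguments admissible_norms {R} m {d} r.

(* Main.v *)
Require Import Defs.
From HB Require Import structures.
From mathcomp Require Import all_boot all_order all_algebra.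
From mathcomp Require Import all_classical all_reals all_analysis.
From mathcomp Require Import ring lra.

Set Implicit Arguments.
Unset Strict Implicit.
Unset Printing Implicit Defensive.

Import Order.TTheory GRing.Theory Num.Theory.

Local Open Scope ring_scope.

(** Upper bound.  With q_k = r_k + log d, assign each job greedily for the
    potential
      Phi(L) = sum_k (3 q_k)^(- q_k) * ||L(k) / T_k||_(r_k)^(q_k).
    As q_k >= r_k >= 1, the increments of Phi are monotone in the current loads,
    so the total increment along the greedy run is at most the increment caused
    by adding the whole optimal load O on top of the final greedy load L:
    2 Phi(L) <= Phi(L + O).  By Minkowski's inequality
    ||L(k) + O(k)|| <= ||L(k)|| + T_k, and (x + 1)^q <= 3/2 x^q for x >= 3 q;
    hence Phi(L) <= 3 d, i.e. ||L(k)|| <= (3 d)^(1 / q_k) 3 q_k T_k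
    <= 18 q_k T_k.

    Lower bound.  Both adversaries forbid all but two machines to each job.  The
    first one halves a set of dimensions: one machine loads the first half, the
    other one the second half, and the game goes on with the half that the
    algorithm has loaded.  After log d jobs some dimension has total load log d,
    while the opposite choices load every dimension at most once.  The second
    one plays a knockout tournament between 2^n machines with n = floor r, the
    winner of a match being the machine that receives its job: the champion
    has load n, while assigning each job to the loser loads every machine at
    most once, with norm at most 2^(n / r) <= 2. *)

(** * Inequalities for real powers *)

Section PowerInequalities.
Context {R : realType}.
Implicit Types p x y a b u v : R.

Lemma powR_homo p x y : 0 <= p -> 0 <= x -> x <= y -> x `^ p <= y `^ p.
Proof.
move=> p0 x0 xy; apply: ge0_ler_powR => //; rewrite nnegrE//.
exact: le_trans xy.
Qed.

Lemma powR_conv p x y a b : 1 <= p -> 0 <= x -> 0 <= y ->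
  0 <= a -> 0 <= b -> a + b = 1 ->
  (a * x + b * y) `^ p <= a * x `^ p + b * y `^ p.
Proof.
move=> p1 x0 y0 a0 b0 ab1.
have a1 : a <= 1 by rewrite -ab1 lerDl.
have -> : b = 1 - a by lra.
by apply: (@convex_powR R p p1 (Itv01 a0 a1) x y);
  rewrite inE/= in_itv/= andbT.
Qed.

(** By convexity: [x + u] and [y] are mirror-image convex combinations of [x] and [y + u], and
    adding the two convexity inequalities compares the sums of powers. Monotonicity then replaces
    [u] by [v]. *)
Lemma powR_increment p x y u v : 1 <= p -> 0 <= x -> x <= y ->
  0 <= u -> u <= v -> (x + u) `^ p - x `^ p <= (y + v) `^ p - y `^ p.
Proof.
move=> p1 x0 xy u0 uv.
have p0 : 0 <= p by apply: le_trans p1.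
suff H : (x + u) `^ p + y `^ p <= x `^ p + (y + u) `^ p.
  have : (y + u) `^ p <= (y + v) `^ p by apply: powR_homo => //; lra.
  by lra.
have [L0|L0] := leP (y + u - x) 0.
  have -> : u = 0 by lra.
  have -> : y = x by lra.
  by rewrite addr0.
set L := y + u - x in L0.
have a0 : 0 <= (y - x) / L by apply: divr_ge0 (ltW L0); rewrite subr_ge0.
have b0 : 0 <= u / L := divr_ge0 u0 (ltW L0).
have ab : (y - x) / L + u / L = 1.
  by rewrite -mulrDl (_ : y - x + u = L) ?divff ?gt_eqF// /L; lra.
have yu0 : 0 <= y + u by lra.
have := powR_conv p1 x0 yu0 a0 b0 ab.
have ba : u / L + (y - x) / L = 1 by rewrite addrC.
have := powR_conv p1 x0 yu0 b0 a0 ba.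
have -> : u / L * x + (y - x) / L * (y + u) = y.
  by rewrite /L; field; rewrite gt_eqF.
have -> : (y - x) / L * x + u / L * (y + u) = x + u.
  by rewrite /L; field; rewrite gt_eqF.
move: a0 b0 ab => _ _ ab.
have -> : (y - x) / L = 1 - u / L by lra.
by lra.
Qed.

(** Minkowski's inequality without roots: after division by [a + b], each summand is a convex
    combination of [x i / a] and [y i / b] with weights [a / (a + b)] and [b / (a + b)]. *)
Lemma powR_sum_triangle (I : finType) (x y : I -> R) p a b : 1 <= p ->
  (forall i, 0 <= x i) -> (forall i, 0 <= y i) -> 0 < a -> 0 < b ->
  \sum_i x i `^ p <= a `^ p -> \sum_i y i `^ p <= b `^ p ->
  \sum_i (x i + y i) `^ p <= (a + b) `^ p.
Proof.
move=> p1 x0 y0 a0 b0 xa yb.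
have ab0 : 0 < a + b by rewrite addr_gt0.
have H i : (x i + y i) `^ p <=
   (a + b) `^ p * (a / (a + b) * (x i / a) `^ p + b / (a + b) * (y i / b) `^ p).
  have -> : x i + y i =
      (a + b) * (a / (a + b) * (x i / a) + b / (a + b) * (y i / b)).
    by field; rewrite !gt_eqF.
  have xa0 : 0 <= x i / a by rewrite divr_ge0 // ltW.
  have yb0 : 0 <= y i / b by rewrite divr_ge0 // ltW.
  have wa0 : 0 <= a / (a + b) by rewrite divr_ge0 // ltW.
  have wb0 : 0 <= b / (a + b) by rewrite divr_ge0 // ltW.
  rewrite powRM ?(ltW ab0) //; last first.
    by apply: addr_ge0; apply: mulr_ge0.
  by rewrite ler_wpM2l ?powR_ge0// powR_conv// -mulrDl divff ?gt_eqF.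
apply: le_trans (ler_sum _ (fun i _ => H i)) _.
rewrite -mulr_sumr ler_piMr ?powR_ge0// big_split/= -!mulr_sumr.
have S z c : (forall i, 0 <= z i) -> 0 < c -> \sum_i z i `^ p <= c `^ p ->
    \sum_(i : I) (z i / c) `^ p <= 1.
  move=> z0 c0 zc.
  have ci0 : 0 <= c^-1 by rewrite invr_ge0 ltW.
  under eq_bigr do rewrite powRM//.
  rewrite -mulr_suml -(ler_pM2r (powR_gt0 p c0)) mul1r -mulrA -powRM ?(ltW c0)//.
  by rewrite mulVf ?gt_eqF// powR1 mulr1.
have := ler_wpM2l (divr_ge0 (ltW a0) (ltW ab0)) (S _ _ x0 a0 xa).
have := ler_wpM2l (divr_ge0 (ltW b0) (ltW ab0)) (S _ _ y0 b0 yb).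
have : a / (a + b) + b / (a + b) = 1 by rewrite -mulrDl divff ?gt_eqF.
by lra.
Qed.

(** Factor out [a]: [(1 + 1 / a) ^ q <= exp (q / a) <= exp (1 / 3) <= 3 / 2]. *)
Lemma powR_addr1_le (q a : R) : 1 <= q -> 3 * q <= a ->
  (a + 1) `^ q <= 3 / 2 * a `^ q.
Proof.
move=> q1 qa.
have a0 : 0 < a by lra.
have -> : a + 1 = (1 + a^-1) * a by field; rewrite gt_eqF.
have ai0 : 0 < a^-1 by rewrite invr_gt0.
rewrite powRM ?(ltW a0)//; last by lra.
rewrite ler_wpM2r ?powR_ge0//.
have qa3 : a^-1 * q <= 3^-1.
  by rewrite ler_pdivrMl// -ler_pdivrMr ?invrK ?invr_gt0//; lra.
apply: (@le_trans _ _ (expR (3^-1))).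
  apply: (@le_trans _ _ (expR (a^-1) `^ q)).
    by apply: powR_homo; [lra|lra|exact: expR_ge1Dx].
  by rewrite -expRM ler_expR.
(* The bound [exp (1 / 3) <= 3 / 2] is the inverse of [exp (- 1 / 3) >= 1 - 1 / 3]. *)
have := @expR_ge1Dx R (- 3^-1).
rewrite expRN => H.
have : (expR (3^-1) : R)^-1 >= 2 / 3 by lra.
move=> /(ler_wpM2r (ltW (expR_gt0 (3^-1 : R)))).
by rewrite mulVf ?gt_eqF ?expR_gt0//; lra.
Qed.

End PowerInequalities.

(** * Schedules as sequences *)

Section Schedules.
Context {R : realType} {m d : nat}.
Implicit Types (p : job R m d) (hist js : seq (job R m d)).
Implicit Types (s : seq (job R m d * 'I_m)) (L : 'M[R]_(m, d)).

Definition place (i : 'I_m) p : 'M[R]_(m, d) :=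
  \matrix_(i', k) if i' == i then p i' k else 0.

Definition loads s : 'M[R]_(m, d) := \sum_(x <- s) place x.2 x.1.

Fixpoint run (a : seq (job R m d) -> job R m d -> 'I_m) hist js :=
  if js is p :: js' then (p, a hist p) :: run a (rcons hist p) js' else [::].

Definition nonneg_jobs js := {in js, forall p, nonneg_job p}.

Lemma place_ge0 i p : nonneg_job p -> nonneg_job (place i p).
Proof. by move=> p0 i' k; rewrite mxE; case: ifP. Qed.

Lemma loads_nil : loads [::] = 0. Proof. exact: big_nil. Qed.

Lemma loads_cons x s : loads (x :: s) = place x.2 x.1 + loads s.
Proof. exact: big_cons. Qed.

Lemma loads_cat s s' : loads (s ++ s') = loads s + loads s'.
Proof. exact: big_cat. Qed.

Lemma nonneg_jobs_cons p js :
  nonneg_jobs (p :: js) <-> nonneg_job p /\ nonneg_jobs js.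
Proof.
split=> [H|[H1 H2] q]; first split.
- by apply: H; rewrite mem_head.
- by move=> q qjs; apply: H; rewrite inE qjs orbT.
- by rewrite inE => /predU1P[->|/H2].
Qed.

Lemma loads_ge0 s : nonneg_jobs (unzip1 s) -> nonneg_job (loads s).
Proof.
elim: s => [|x s IH] /=; first by move=> _ i k; rewrite loads_nil mxE.
move=> /nonneg_jobs_cons[x0 /IH s0] i k; rewrite loads_cons mxE.
by rewrite addr_ge0//; apply: place_ge0.
Qed.

Lemma unzip1_run a hist js : unzip1 (run a hist js) = js.
Proof. by elim: js hist => //= p js IH hist; rewrite IH. Qed.

Lemma run_cat a hist js js' :
  run a hist (js ++ js') = run a hist js ++ run a (hist ++ js) js'.
Proof.
elim: js hist => [|p js IH] hist /=; first by rewrite cats0.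
by rewrite IH cat_rcons.
Qed.

Lemma run_mkseq a p0 hist js :
  run a hist js =
  mkseq (fun j => (nth p0 js j, a (hist ++ take j js) (nth p0 js j))) (size js).
Proof.
elim: js hist => [//|p js IH] hist.
rewrite /mkseq /= cats0 (iotaDl 1 0) -map_comp IH; congr cons.
by apply: eq_map => j /=; rewrite cat_rcons.
Qed.

Lemma loadE n (jobs : n.-tuple (job R m d)) (f : 'I_n -> 'I_m) k :
  load jobs f k =
  fun i => loads [seq (tnth jobs j, f j) | j <- enum 'I_n] i k.
Proof.
apply/funext => i; rewrite /load /loads big_map big_enum/= summxE big_mkcond/=.
by apply: eq_bigr => j _; rewrite mxE eq_sym.
Qed.

Lemma load_onlineE (A : online_algorithm R m d) r T n
    (jobs : n.-tuple (job R m d)) k :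
  load jobs (online_assignment A r T jobs) k =
  fun i => loads (run (A r T) [::] jobs) i k.
Proof.
rewrite loadE; apply/funext => i; congr (loads _ i k).
rewrite (run_mkseq _ (const_mx 0)) size_tuple /mkseq -val_enum_ord -map_comp.
by apply: eq_map => j /=; rewrite /online_assignment (tnth_nth (const_mx 0)).
Qed.

(** Trades tuples and functions on ordinals for one list [s], which carries both the jobs and the
    offline assignment witnessing feasibility. *)
Lemma competitiveP (A : online_algorithm R m d) r alpha :
  competitive A r alpha <->
  forall T s, nonneg_jobs (unzip1 s) ->
    (forall k, Lr_norm (r k) (fun i => loads s i k) <= T k) ->
    forall k, Lr_norm (r k) (fun i => loads (run (A r T) [::] (unzip1 s)) i k)
              <= alpha k * T k.
Proof.
split=> [Acomp T s s0 sT k|H T n jobs jobs0 [f fT] k].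
  rewrite -(load_onlineE A r T (in_tuple (unzip1 s))); apply: Acomp => [|{k}].
    by move=> j; apply: s0; apply: mem_tnth.
  case: s sT {s0} => [|x0 s'] sT.
    have f (j : 'I_0) : 'I_m by case: j.
    exists f => k'; rewrite loadE; have := sT k'.
    by rewrite (_ : enum _ = [::])//; apply: size0nil; rewrite size_enum_ord.
  move: (x0 :: s') sT => s sT.
  exists (fun j => (nth x0 s j).2) => k'; rewrite loadE.
  set s2 := map _ _; suff -> : s2 = s by [].
  rewrite /s2 -[RHS](mkseq_nth x0) -(size_map fst s) /mkseq.
  rewrite -val_enum_ord -map_comp.
  apply: eq_map => j /=; rewrite (tnth_nth x0.1)/= (nth_map x0)//; last first.
    by case: j => j /=; rewrite size_map.
  by case: nth.
have e : unzip1 [seq (tnth jobs j, f j) | j <- enum 'I_n] = jobs.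
  by rewrite /unzip1 -map_comp -[RHS]map_tnth_enum.
rewrite load_onlineE -e; apply: H => [|k'].
  by rewrite e => p /tnthP[j ->].
by rewrite -loadE.
Qed.

End Schedules.

(** * The greedy algorithm *)

Section Greedy.
Context {R : realType} {m d : nat}.
Implicit Types (p : job R m d) (hist js : seq (job R m d)).
Implicit Types (s : seq (job R m d * 'I_m)) (L G P : 'M[R]_(m, d)).

Definition mxle L G := forall i k, L i k <= G i k.

Variables (i0 : 'I_m) (allowed : job R m d -> pred 'I_m).
Variable F : 'M[R]_(m, d) -> R.

Definition greedy_choice L p : 'I_m :=
  if [pick i | allowed p i] is Some i1
  then [arg min_(i < i1 | allowed p i) F (L + place i p)]%O else i0.

Definition greedy_step L p := L + place (greedy_choice L p) p.

(** The current loads are replayed from the history, since an online algorithm is not passed its own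
    earlier decisions. *)
Definition greedy hist p := greedy_choice (foldl greedy_step 0 hist) p.

Lemma greedy_choiceP L p i : allowed p i ->
  allowed p (greedy_choice L p) /\
  F (greedy_step L p) <= F (L + place i p).
Proof.
move=> ai; rewrite /greedy_step /greedy_choice.
case: pickP => [i1 ai1|/(_ i)]; last by rewrite ai.
by case: arg_minP => // j aj H; split=> //; apply: H.
Qed.

Lemma loads_run_greedy js :
  loads (run greedy [::] js) = foldl greedy_step 0 js.
Proof.
suff H hist : foldl greedy_step 0 hist + loads (run greedy hist js) =
    foldl greedy_step (foldl greedy_step 0 hist) js.
  by have := H [::]; rewrite /= add0r.
elim: js hist => [|p js IH] hist /=; first by rewrite loads_nil addr0.
by rewrite loads_cons addrA -/(greedy_step _ p) -foldl_rcons IH.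
Qed.

Lemma mxle_foldl_greedy L js : nonneg_jobs js -> mxle L (foldl greedy_step L js).
Proof.
elim: js L => [|p js IH] L; first by move=> _ i k.
move=> /nonneg_jobs_cons [p0 js0] i k /=.
apply: le_trans (IH _ js0 i k); rewrite mxE lerDl.
exact: place_ge0.
Qed.

Lemma run_greedy_allowed s :
  {in s, forall x, allowed x.1 x.2} ->
  {in run greedy [::] (unzip1 s), forall x, allowed x.1 x.2}.
Proof.
elim: s [::] => [|x s IH] hist H y //=.
rewrite inE => /predU1P[->|]; last first.
  by apply: IH => z zs; apply: H; rewrite inE zs orbT.
by case: (greedy_choiceP (foldl greedy_step 0 hist) (H _ (mem_head _ _))).
Qed.

Hypothesis F_supermodular : forall L G P,
  nonneg_job L -> mxle L G -> nonneg_job P -> F (L + P) - F L <= F (G + P) - F G.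

(** For each job, the greedy increment is at most that of the offline choice at the current loads,
    hence, by supermodularity, at most that at [G], which dominates all loads of the run. *)
Lemma greedy_increment s L G : nonneg_jobs (unzip1 s) ->
  {in s, forall x, allowed x.1 x.2} -> nonneg_job L ->
  mxle (foldl greedy_step L (unzip1 s)) G ->
  F (foldl greedy_step L (unzip1 s)) - F L <= F (G + loads s) - F G.
Proof.
elim: s L G => [|x s IH] L G /=; first by rewrite loads_nil addr0 !subrr.
move=> /nonneg_jobs_cons [x0 s0] H L0 LG.
have [_ Fle] := greedy_choiceP L (H _ (mem_head _ _)).
have step0 : nonneg_job (greedy_step L x.1).
  by move=> i k; rewrite mxE addr_ge0//; apply: place_ge0.
have Hs : {in s, forall x, allowed x.1 x.2}.
  by move=> z zs; apply: H; rewrite inE zs orbT.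
have LG0 : mxle L G.
  move=> i k; apply: le_trans (LG i k); apply: le_trans (mxle_foldl_greedy _ s0 i k).
  by rewrite mxE lerDl; apply: place_ge0.
have := F_supermodular L0 LG0 (place_ge0 x.2 x0).
(* [G] absorbs the offline placement, so that the increments on the right telescope. *)
have := IH _ (G + place x.2 x.1) s0 Hs step0.
rewrite loads_cons addrA => H1 H2.
have : mxle (foldl greedy_step (greedy_step L x.1) (unzip1 s))
            (G + place x.2 x.1).
  move=> i k; apply: le_trans (LG i k) _; rewrite mxE lerDl; exact: place_ge0.
by move=> /H1; lra.
Qed.

Lemma greedy_doubling s : nonneg_jobs (unzip1 s) ->
  {in s, forall x, allowed x.1 x.2} ->
  let L := loads (run greedy [::] (unzip1 s)) in
  2 * F L <= F (L + loads s) + F 0.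
Proof.
move=> s0 H /=; rewrite loads_run_greedy.
have z0 : nonneg_job (0 : 'M[R]_(m, d)) by move=> i k; rewrite mxE.
have := greedy_increment s0 H z0 (fun _ _ => lexx _); lra.
Qed.

End Greedy.

(** * A weighted sum of powers of norms as a supermodular potential *)

Section Potential.
Context {R : realType} {m d : nat}.
Variables (w e r T : 'I_d -> R).
Hypothesis w0 : forall k, 0 <= w k.
Hypothesis e1 : forall k, 1 <= e k.
Hypothesis r1 : forall k, 1 <= r k.
Hypothesis T0 : forall k, 0 <= T k.

(** The inner sum is the [r k]-th power of the norm of the loads scaled by [T k]. Taking
    [e k = q k / r k] turns it into the [q k]-th power, while both exponents stay at least 1. *)
Definition potential (L : 'M[R]_(m, d)) : R :=
  \sum_k w k * (\sum_i (L i k / T k) `^ r k) `^ e k.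

Lemma potential_incrementE L P :
  potential (L + P) - potential L =
  \sum_k w k * ((\sum_i ((L + P) i k / T k) `^ r k) `^ e k -
                (\sum_i (L i k / T k) `^ r k) `^ e k).
Proof. by rewrite -sumrB; apply: eq_bigr => k _; rewrite -mulrBr. Qed.

(** Monotonicity of increments of powers is used twice: for the exponent [r k] on each machine, then
    for [e k] on the sum over the machines. *)
Lemma potential_supermodular L G P :
  nonneg_job L -> mxle L G -> nonneg_job P ->
  potential (L + P) - potential L <= potential (G + P) - potential G.
Proof.
move=> L0 LG P0.
rewrite [leLHS]potential_incrementE [leRHS]potential_incrementE.
apply: ler_sum => k _; apply: (ler_wpM2l (w0 k)).
set S := fun L : 'M[R]_(m, d) => \sum_i (L i k / T k) `^ r k.
have S0 X : 0 <= S X by apply: sumr_ge0 => i _; exact: powR_ge0.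
have r0 : 0 <= r k by apply: le_trans (r1 k).
have Tk : 0 <= (T k)^-1 by rewrite invr_ge0.
have SD X : S (X + P) = S X + (S (X + P) - S X) by rewrite addrCA subrr addr0.
change (S (L + P) `^ e k - S L `^ e k <= S (G + P) `^ e k - S G `^ e k).
rewrite (SD L) (SD G).
apply: powR_increment => //.
- apply: ler_sum => i _; apply: powR_homo => //; first exact: mulr_ge0.
  exact: ler_wpM2r.
- rewrite -sumrB; apply: sumr_ge0 => i _.
  rewrite subr_ge0; apply: powR_homo => //; first exact: mulr_ge0.
  by apply: ler_wpM2r => //; rewrite mxE lerDl.
- rewrite -!sumrB; apply: ler_sum => i _; rewrite !mxE !mulrDl.
  apply: powR_increment => //; [exact: mulr_ge0|exact: ler_wpM2r|exact: mulr_ge0].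
Qed.

Lemma potential0 : potential 0 = 0.
Proof.
rewrite /potential big1// => k _; rewrite big1 => [|i _].
  by rewrite powR0 ?mulr0// gt_eqF// (lt_le_trans ltr01).
by rewrite mxE mul0r powR0// gt_eqF// (lt_le_trans ltr01).
Qed.

End Potential.

(** * The L_r norm and its r-th power *)

Section LrNorm.
Context {R : realType} {m : nat}.
Implicit Types (r : R) (x : 'I_m -> R).

Lemma Lr_norm_ge0 r x : 0 <= Lr_norm r x.
Proof. exact: powR_ge0. Qed.

Lemma Lr_norm_powR r x : 1 <= r -> Lr_norm r x `^ r = \sum_i x i `^ r.
Proof.
move=> r1; have r0 : 0 < r by apply: lt_le_trans r1.
rewrite /Lr_norm -powRrM mulVf ?gt_eqF// powRr1//.
by apply: sumr_ge0 => i _; exact: powR_ge0.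
Qed.

Lemma Lr_norm_le r x t : 1 <= r -> 0 <= t ->
  (Lr_norm r x <= t) = (\sum_i x i `^ r <= t `^ r).
Proof.
move=> r1 t0; rewrite -Lr_norm_powR//; have r0 : 0 < r by apply: lt_le_trans r1.
apply/idP/idP => [|H]; first by apply: powR_homo; rewrite ?Lr_norm_ge0 ?ltW.
rewrite leNgt; apply/negP => /(gt0_ltr_powR r0).
by rewrite !nnegrE Lr_norm_ge0 t0 ltNge H => /(_ isT isT).
Qed.

Lemma le_Lr_norm r x i : 1 <= r -> 0 <= x i -> x i <= Lr_norm r x.
Proof.
move=> r1 xi0; have r0 : 0 < r by apply: lt_le_trans r1.
rewrite leNgt; apply/negP => /(gt0_ltr_powR r0).
rewrite !nnegrE Lr_norm_ge0 xi0 => /(_ isT isT).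
rewrite ltNge Lr_norm_powR// (bigD1 i)//= lerDl => /negP; apply.
by apply: sumr_ge0 => j _; exact: powR_ge0.
Qed.

Lemma Lr_norm0 r : 1 <= r -> Lr_norm r (fun _ : 'I_m => 0) = 0.
Proof.
move=> r1; have r0 : 0 < r by apply: lt_le_trans r1.
rewrite /Lr_norm big1 => [|i _]; last by rewrite powR0 ?gt_eqF.
by rewrite powR0// gt_eqF// invr_gt0.
Qed.

End LrNorm.

(** * Base-2 logarithms *)

Section Log2.
Context {R : realType}.

Lemma ln2_gt0 : 0 < ln (2 : R).
Proof. by rewrite ln_gt0// ltr1n. Qed.

Lemma powR_log2 (x : R) : 0 < x -> 2 `^ log2 x = x.
Proof.
move=> x0; rewrite /powR gt_eqF// divfK ?lnK ?gt_eqF ?ln2_gt0//.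
Qed.

Lemma log2_ge0 n : (0 < n)%N -> 0 <= log2 (n%:R : R).
Proof.
by move=> n0; rewrite divr_ge0 ?(ltW ln2_gt0)// ln_ge0// ler1n.
Qed.

Lemma powR2_le_log2 (x y : R) : 0 < y -> (2 `^ x <= y) = (x <= log2 y).
Proof.
move=> y0; rewrite -{1}(powR_log2 y0) /powR gt_eqF// ler_expR ler_pM2r//.
exact: ln2_gt0.
Qed.

End Log2.

(** * Bounding the greedy potential *)

Section UpperBound.
Context {R : realType} {m d : nat}.
Variables (r T : 'I_d -> R).
Hypothesis r1 : forall k, 1 <= r k.
Hypothesis d0 : (0 < d)%N.

Definition exponent k : R := r k + log2 d%:R.

(* Dimensions with [T k = 0] do not contribute, because [x / 0 = 0]; they are
   taken care of by [greedy_allowed]. *)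
Definition greedy_potential : 'M[R]_(m, d) -> R :=
  potential (fun k => (3 * exponent k) `^ (- exponent k))
            (fun k => exponent k / r k) r T.

Definition greedy_allowed (p : job R m d) (i : 'I_m) :=
  [forall k, (T k == 0) ==> (p i k == 0)].

Lemma exponent_ge1 k : 1 <= exponent k.
Proof. by have := r1 k; have := @log2_ge0 R _ d0; rewrite /exponent; lra. Qed.

Let r_gt0 k : 0 < r k. Proof. exact: lt_le_trans (r1 k). Qed.

Lemma exponent_div_ge1 k : 1 <= exponent k / r k.
Proof.
by rewrite ler_pdivlMr// mul1r lerDl log2_ge0.
Qed.

Let norm L k := \sum_(i < m) (L i k / T k) `^ r k.

Lemma potential_term_add (L O : 'M[R]_(m, d)) k : 0 <= T k ->
  nonneg_job L -> nonneg_job O -> norm O k <= 1 ->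
  norm (L + O) k `^ (exponent k / r k) <=
  3 / 2 * (norm L k `^ (exponent k / r k) + (3 * exponent k) `^ exponent k).
Proof.
move=> Tk0 L0 O0 O1; set q := exponent k; set x := norm L k `^ (r k)^-1.
have q1 : 1 <= q := exponent_ge1 k.
have e1 := exponent_div_ge1 k; rewrite -/q in e1.
have x0 : 0 <= x by exact: powR_ge0.
have n0 X : 0 <= norm X k by apply: sumr_ge0 => i _; exact: powR_ge0.
have Ti : 0 <= (T k)^-1 by rewrite invr_ge0.
(* Raising the norm [x] to at least [3 * q] makes [powR_addr1_le] applicable. The price is the
   additive term, as [a ^ q] is either [x ^ q] or [(3 * q) ^ q]. *)
pose a := Num.max x (3 * q).
have xa : x <= a by rewrite le_max lexx.
have qa : 3 * q <= a by rewrite le_max lexx orbT.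
have a0 : 0 < a by lra.
have xr : x `^ r k = norm L k by rewrite -powRrM mulVf ?gt_eqF// powRr1.
have -> : norm L k `^ (q / r k) = x `^ q by rewrite -powRrM mulrC.
have Sle : norm (L + O) k <= (a + 1) `^ r k.
  rewrite /norm; under eq_bigr do rewrite mxE mulrDl.
  apply: powR_sum_triangle => //; try by move=> i; apply: mulr_ge0.
  - by rewrite -/(norm L k) -xr; apply: powR_homo => //; apply: ltW.
  - by rewrite powR1.
apply: (@le_trans _ _ ((a + 1) `^ q)).
  rewrite [leRHS](_ : _ = ((a + 1) `^ r k) `^ (q / r k)).
    by apply: powR_homo => //; lra.
  by rewrite -powRrM mulrCA divff ?mulr1// gt_eqF.
apply: le_trans (powR_addr1_le q1 qa) _; apply: ler_wpM2l => //.
by rewrite /a /Num.max; case: ifP => _; rewrite ?lerDl ?lerDr; exact: powR_ge0.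
Qed.

(** The weights turn the additive terms into 1 per dimension, so
    [Phi (L + O) <= 3 / 2 * (Phi L + d)]. With the doubling hypothesis, [Phi L <= 3 * d], and each
    term is at most the whole sum. *)
Lemma potential_term_le (L O : 'M[R]_(m, d)) : (forall k, 0 <= T k) ->
  nonneg_job L -> nonneg_job O -> (forall k, norm O k <= 1) ->
  2 * greedy_potential L <= greedy_potential (L + O) ->
  forall k, norm L k `^ (exponent k / r k) <=
            3 * d%:R * (3 * exponent k) `^ exponent k.
Proof.
move=> T0 L0 O0 O1.
pose w k := (3 * exponent k) `^ (- exponent k).
have q0 k : 0 < 3 * exponent k by have := exponent_ge1 k; lra.
have w0 k : 0 < w k by apply: powR_gt0.
have wq k : w k * (3 * exponent k) `^ exponent k = 1.
  by rewrite /w powRN mulVf// gt_eqF//; apply: powR_gt0.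
have H1 : greedy_potential (L + O) <= 3 / 2 * (greedy_potential L + d%:R).
  have -> : d%:R = \sum_(k < d) 1 :> R by rewrite sumr_const card_ord.
  rewrite /greedy_potential /potential -big_split/= mulr_sumr.
  apply: ler_sum => k _.
  have := ler_wpM2l (ltW (w0 k)) (potential_term_add (T0 k) L0 O0 (O1 k)).
  by rewrite (mulrCA (w k)) (mulrDr (w k)) wq.
move=> H2 k; have H : greedy_potential L <= 3 * d%:R.
  move: (greedy_potential L) (greedy_potential (L + O)) H1 H2 => x y; lra.
rewrite -(ler_pM2l (w0 k)) [leRHS]mulrCA wq mulr1; apply: le_trans H.
rewrite /greedy_potential /potential (bigD1 k)//= lerDl.
by apply: sumr_ge0 => k' _; rewrite mulr_ge0// powR_ge0.
Qed.

End UpperBound.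

(** * Total loads against single jobs *)

Section LoadBounds.
Context {R : realType} {m d : nat}.
Implicit Types (s : seq (job R m d * 'I_m)).

Lemma loads_ge_mem s x k : nonneg_jobs (unzip1 s) -> x \in s ->
  x.1 x.2 k <= loads s x.2 k.
Proof.
elim: s => [//|y s IH] /=; move=> /nonneg_jobs_cons [y0 s0].
rewrite loads_cons mxE inE => /predU1P[->|xs].
  by rewrite mxE eqxx lerDl; apply: loads_ge0.
by rewrite ler_wpDl ?IH//; apply: place_ge0.
Qed.

Lemma loads_eq0 s i k : (forall x, x \in s -> x.1 x.2 k = 0) -> loads s i k = 0.
Proof.
move=> H; rewrite /loads summxE big1_seq// => x /H x0.
by rewrite mxE; case: eqP => [->|].
Qed.

End LoadBounds.

(** * Competitiveness of the greedy algorithm *)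

Section UpperBound.
Context {R : realType} {m d : nat}.

Lemma normalized_le1 (r T : R) (x : 'I_m -> R) : 1 <= r -> (forall i, 0 <= x i) ->
  Lr_norm r x <= T -> \sum_i (x i / T) `^ r <= 1.
Proof.
move=> r1 x0 xT; have r0 : 0 < r by apply: lt_le_trans r1.
have T0 : 0 <= T := le_trans (Lr_norm_ge0 _ _) xT.
have Ti : 0 <= T^-1 by rewrite invr_ge0.
move: T0; rewrite le_eqVlt => /predU1P[<-|T0].
  (* For [T = 0] all quotients vanish, because [x / 0 = 0]. *)
  by rewrite big1// => i _; rewrite invr0 mulr0 powR0 ?gt_eqF.
under eq_bigr do rewrite powRM//.
rewrite -mulr_suml -(ler_pM2r (powR_gt0 r T0)) mul1r -mulrA -powRM ?(ltW T0)//.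
by rewrite mulVf ?gt_eqF// powR1 mulr1 -Lr_norm_le// ltW.
Qed.

(** As [3 <= 3 ^ q] and [n <= 2 ^ q], the bound on [S ^ (q / r)] is at most [(3 * 2 * 3 * q) ^ q],
    which is where 18 comes from. *)
Lemma exponent_root_bound (r q n S : R) : 1 <= r -> r <= q -> 0 <= S ->
  0 <= n -> n <= 2 `^ q ->
  S `^ (q / r) <= 3 * n * (3 * q) `^ q -> S <= (18 * q) `^ r.
Proof.
move=> r1 rq S0 n0 nq H.
have r0 : 0 < r by lra.
have q0 : 0 < q by lra.
rewrite leNgt; apply/negP => /(gt0_ltr_powR (divr_gt0 q0 r0)).
rewrite !nnegrE powR_ge0 S0 -powRrM mulrCA divff ?gt_eqF// mulr1 => /(_ isT isT).
apply/negP; rewrite -leNgt; apply: le_trans H _.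
have -> : 18 * q = 3 * 2 * (3 * q) by ring.
have c0 : 0 <= 3 * 2 :> R by lra.
have q30 : 0 <= 3 * q by lra.
rewrite (powRM _ c0 q30); apply: ler_wpM2r; first exact: powR_ge0.
rewrite powRM//; apply: ler_pM => //.
by apply: le1r_powR; lra.
Qed.

Lemma greedy_competitive (i0 : 'I_m) (r : 'I_d -> R) : (0 < d)%N ->
  (forall k, 1 <= r k) ->
  competitive (fun r T => greedy i0 (greedy_allowed T) (greedy_potential r T)) r
    (fun k => 18 * (r k + log2 d%:R)).
Proof.
move=> d0 r1; apply/competitiveP => T s s0 sT k.
have O0 := loads_ge0 s0.
have T0 k' : 0 <= T k' := le_trans (Lr_norm_ge0 _ _) (sT k').
(* Where the target is zero, the offline norm is zero and so is the load of each job on its offline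
   machine. Hence every job has an allowed machine. *)
have okO : {in s, forall x, greedy_allowed T x.1 x.2}.
  move=> x xs; apply/forallP => k'; apply/implyP => /eqP Tk0.
  rewrite eq_le (s0 _ (map_f _ xs)) andbT -Tk0.
  apply: le_trans (loads_ge_mem k' s0 xs) _; apply: le_trans (sT k').
  exact: (@le_Lr_norm _ _ (r k') (fun i => loads s i k')).
set A := greedy _ _ _.
have L0 : nonneg_job (loads (run A [::] (unzip1 s))).
  by apply: loads_ge0; rewrite unzip1_run.
have okL : {in run A [::] (unzip1 s), forall x, greedy_allowed T x.1 x.2}.
  exact: run_greedy_allowed.
have [Tk0|Tk0] := eqVneq (T k) 0.
  rewrite Tk0 mulr0 (_ : (fun=> _) = fun=> 0) ?Lr_norm0//; apply/funext => i.
  apply: loads_eq0 => x /okL /forallP /(_ k).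
  by rewrite Tk0 eqxx => /eqP.
have {Tk0} Tk0 : 0 < T k by rewrite lt_neqAle eq_sym Tk0 T0.
have super (L G P : 'M[R]_(m, d)) : nonneg_job L -> mxle L G -> nonneg_job P ->
    greedy_potential r T (L + P) - greedy_potential r T L <=
    greedy_potential r T (G + P) - greedy_potential r T G.
  apply: potential_supermodular => //; last exact: exponent_div_ge1.
  by move=> k'; exact: powR_ge0.
have pot0 : greedy_potential (m := m) r T 0 = 0.
  exact: potential0 (exponent_div_ge1 r1 d0) r1.
move: (greedy_doubling i0 super s0 okO).
rewrite /= -/A pot0 addr0; move: L0; set L := loads (run A _ _) => L0 H.
have := potential_term_le r1 d0 T0 L0 O0
  (fun k => normalized_le1 (r1 k) (O0^~ k) (sT k)) H k.
set S := \sum_i _ => HS.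
have log0 : 0 <= log2 (d%:R : R) := log2_ge0 d0.
have : S <= (18 * exponent r k) `^ r k.
  apply: exponent_root_bound HS => //.
  - by rewrite lerDl.
  - by apply: sumr_ge0 => i _; exact: powR_ge0.
  (* Here [d = 2 ^ log2 d], and [log2 d] is a summand of the exponent. *)
  - rewrite -{1}(@powR_log2 _ d%:R) ?ltr0n// ler_powR ?ler1n//.
    by rewrite lerDr (le_trans ler01).
have q0 : 0 <= 18 * exponent r k by rewrite mulr_ge0// addr_ge0// (le_trans _ (r1 k)).
rewrite -(ler_pM2r (powR_gt0 (r k) Tk0)) -powRM//.
rewrite -/(exponent r k) (Lr_norm_le _ (r1 k) (mulr_ge0 q0 (T0 k))); apply: le_trans.
rewrite /S mulr_suml; apply: ler_sum => i _.
by rewrite -powRM ?(ltW Tk0) ?divr_ge0 ?(ltW Tk0)// divfK ?gt_eqF.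
Qed.

End UpperBound.

(** * Adversaries *)

Section Adversaries.
Context {R : realType} {m d : nat}.
Variables (a : seq (job R m d) -> job R m d -> 'I_m) (B : R).
Hypothesis B0 : 0 <= B.
Implicit Types (p : job R m d) (hist js : seq (job R m d)).
Implicit Types (s : seq (job R m d * 'I_m)).

Lemma sum_place i p k : \sum_i' place i p i' k = p i k.
Proof.
rewrite (bigD1 i)//= mxE eqxx big1 ?addr0// => j ji.
by rewrite mxE (negPf ji).
Qed.

Lemma loads_run_ge0 hist js i k : nonneg_jobs js -> 0 <= loads (run a hist js) i k.
Proof. by move=> js0; apply: loads_ge0; rewrite unzip1_run. Qed.

(** The partition is stated through indicators in [R], because the adversaries bound loads by
    indicators. *)
Lemma uniq_halves (T : eqType) h (X : seq T) : uniq X -> size X = (2 ^ h.+1)%N ->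
  exists X1 X2, [/\ uniq X1, uniq X2, size X1 = (2 ^ h)%N, size X2 = (2 ^ h)%N &
    forall x, (x \in X1)%:R + (x \in X2)%:R = (x \in X)%:R :> R].
Proof.
move=> Xu Xs; exists (take (2 ^ h) X), (drop (2 ^ h) X).
have hX : (2 ^ h <= size X)%N by rewrite Xs leq_exp2l.
move: Xu; rewrite -{1}(cat_take_drop (2 ^ h) X) cat_uniq => /and3P[u1 D u2].
split=> //; first by rewrite size_takel.
  by rewrite size_drop Xs expnS mul2n -addnn addnK.
move=> x; rewrite -[in RHS](cat_take_drop (2 ^ h) X) mem_cat.
case: (boolP (x \in take _ _)) => x1; last by rewrite add0r.
case: (boolP (x \in drop _ _)) => x2; last by rewrite addr0.
by case/hasP: D; exists x.
Qed.

(* In both adversaries [s] is the offline schedule, and the algorithm [a] is run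
   on the same jobs after the history [hist]; [B] is the load of a job on the
   machines forbidden to it. *)
Lemma dimension_adversary (i0 i1 : 'I_m) : i0 != i1 ->
  forall h (S : seq 'I_d) hist, uniq S -> size S = (2 ^ h)%N ->
  exists s, [/\ nonneg_jobs (unzip1 s),
    forall k, \sum_i loads s i k <= (k \in S)%:R &
    (exists i k, B <= loads (run a hist (unzip1 s)) i k) \/
    (exists k, k \in S /\
      h%:R <= loads (run a hist (unzip1 s)) i0 k + loads (run a hist (unzip1 s)) i1 k)].
Proof.
move=> i01; elim=> [|h IH] S hist Su Ss.
  exists [::]; split=> // [k|].
    by rewrite big1 ?ler0n// => i _; rewrite loads_nil mxE.
  case: S Ss {Su} => // k S _; right; exists k.
  by rewrite mem_head loads_nil !mxE addr0.
have [S0 [S1 [u0 u1 size0 size1 S01]]] := uniq_halves Su Ss.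
(* Machine [i0] loads one half, [i1] the other; [B] deters from all other machines. *)
pose p : job R m d := \matrix_(i, k)
  if i == i0 then (k \in S0)%:R else if i == i1 then (k \in S1)%:R else B.
have p0 : nonneg_job p by move=> i k; rewrite mxE; do 2?case: ifP.
have pi0 k : p i0 k = (k \in S0)%:R by rewrite mxE eqxx.
have pi1 k : p i1 k = (k \in S1)%:R by rewrite mxE eqxx eq_sym (negPf i01).
(* Covers both legal answers: the algorithm uses [c], the offline schedule the other machine [c'],
   and the game goes on with [Sc], which [c'] leaves free of load. *)
have step c c' (Sc Sc' : seq 'I_d) : a hist p = c -> c \in [:: i0; i1] ->
    uniq Sc -> size Sc = (2 ^ h)%N ->
    (forall k, p c k = (k \in Sc)%:R) -> (forall k, p c' k = (k \in Sc')%:R) ->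
    (forall k, (k \in Sc)%:R + (k \in Sc')%:R = (k \in S)%:R :> R) ->
    exists s, [/\ nonneg_jobs (unzip1 s),
      forall k, \sum_i loads s i k <= (k \in S)%:R &
      (exists i k, B <= loads (run a hist (unzip1 s)) i k) \/
      (exists k, k \in S /\
        h.+1%:R <= loads (run a hist (unzip1 s)) i0 k +
                   loads (run a hist (unzip1 s)) i1 k)].
  move=> ac ci uc sc pc pc' Scc'.
  have [s [s0 sS alt]] := IH Sc (rcons hist p) uc sc.
  exists ((p, c') :: s); split=> /=; first exact/nonneg_jobs_cons.
    move=> k; under eq_bigr do rewrite loads_cons mxE.
    rewrite big_split/= sum_place pc' -Scc' addrC lerD2r//.
  have pl i k : 0 <= place (a hist p) p i k by apply: place_ge0.
  case: alt => [[i [k Bik]]|[k [kS hk]]].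
    by left; exists i, k; rewrite loads_cons mxE ler_wpDl.
  right; exists k; split.
    by move: (Scc' k); rewrite kS; case: (k \in S) => //; case: (k \in Sc') => /=; lra.
  have pck : place (a hist p) p c k = 1 by rewrite mxE ac eqxx pc kS.
  have H : 1 <= place (a hist p) p i0 k + place (a hist p) p i1 k.
    by move: ci pck; rewrite !inE => /orP[]/eqP-> ->; rewrite ?lerDl ?lerDr.
  rewrite loads_cons [leRHS](_ : _ =
    (place (a hist p) p i0 k + place (a hist p) p i1 k) +
    (loads (run a (rcons hist p) (unzip1 s)) i0 k +
     loads (run a (rcons hist p) (unzip1 s)) i1 k)); last first.
    by rewrite addrACA; congr (_ + _); rewrite mxE.
  by rewrite -nat1r lerD.
have [c0|c0] := eqVneq (a hist p) i0.
  by apply: (step i0 i1 S0 S1) => //; rewrite inE eqxx.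
have [c1|c1] := eqVneq (a hist p) i1.
  apply: (step i1 i0 S1 S0) => //; first by rewrite !inE eqxx orbT.
  by move=> k; rewrite addrC.
(* A forbidden machine has been used, so this single job suffices. *)
exists [:: (p, i0)]; split=> /=.
- by apply/nonneg_jobs_cons.
- move=> k; under eq_bigr do rewrite loads_cons loads_nil addr0.
  by rewrite sum_place pi0 -S01 lerDl.
- case: S Ss {Su S01 step} => [/eqP|k S _]; first by rewrite eq_sym expn_eq0.
  left; exists (a hist p), k; rewrite loads_cons loads_nil addr0 !mxE eqxx.
  by rewrite (negPf c0) (negPf c1).
Qed.

(** The induction keeps the champion free of offline load, so that the loser of the next match can
    take its job offline with total load 1. The second half is played with the jobs of the first
    half in its history. *)
Lemma tournament_adversary h (X : seq 'I_m) hist : uniq X -> size X = (2 ^ h)%N ->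
  (0 < d)%N ->
  exists s, [/\ nonneg_jobs (unzip1 s),
    forall i k, loads s i k <= (i \in X)%:R &
    (exists i k, B <= loads (run a hist (unzip1 s)) i k) \/
    (exists i, [/\ i \in X, forall k, loads s i k = 0 &
      forall k, h%:R <= loads (run a hist (unzip1 s)) i k])].
Proof.
move=> Xu Xs d0; elim: h X hist Xu Xs => [|h IH] X hist Xu Xs.
  exists [::]; split=> // [i k|]; first by rewrite loads_nil mxE.
  case: X Xs {Xu} => // i X _; right; exists i.
  by split=> [|k|k]; rewrite ?mem_head// loads_nil mxE.
have [X1 [X2 [u1 u2 size1 size2 X12]]] := uniq_halves Xu Xs.
have [s1 [s10 s1X alt1]] := IH X1 hist u1 size1.
have [s2 [s20 s2X alt2]] := IH X2 (hist ++ unzip1 s1) u2 size2.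
have nn js js' : nonneg_jobs js -> nonneg_jobs js' -> nonneg_jobs (js ++ js').
  by move=> H H' q; rewrite mem_cat => /orP[/H|/H'].
have g1 i k := loads_ge0 s10 i k.
have g2 i k := loads_ge0 s20 i k.
have r1 i k := loads_run_ge0 hist i k s10.
have r2 i k := loads_run_ge0 (hist ++ unzip1 s1) i k s20.
case: alt1 => [alt1|[i1 [i1X z1 w1]]].
  exists s1; split=> //; last by left.
  by move=> i k; apply: le_trans (s1X i k) _; rewrite -X12 lerDl.
case: alt2 => [[i [k Bik]]|[i2 [i2X z2 w2]]].
  exists (s1 ++ s2); rewrite /unzip1 map_cat -!/(unzip1 _); split.
  - exact: nn.
  - by move=> i' k'; rewrite loads_cat mxE -X12 lerD.
  - by left; exists i, k; rewrite run_cat loads_cat mxE ler_wpDl.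
have i1X2 : i1 \in X2 = false.
  by have := X12 i1; rewrite i1X; case: (i1 \in X2) => //; case: (i1 \in X) => /=; lra.
have i2X1 : i2 \in X1 = false.
  by have := X12 i2; rewrite i2X; case: (i2 \in X1) => //; case: (i2 \in X) => /=; lra.
(* A machine outside [X2] gets no offline load from [s2]; so both finalists enter the last match
   with none. *)
have z1' k : loads s2 i1 k = 0.
  by apply/eqP; rewrite eq_le g2 andbT (le_trans (s2X _ _))// i1X2.
have z2' k : loads s1 i2 k = 0.
  by apply/eqP; rewrite eq_le g1 andbT (le_trans (s1X _ _))// i2X1.
have i12 : i1 != i2 by apply: contraFneq i1X2 => ->.
pose p : job R m d := \matrix_(i, k) if i \in [:: i1; i2] then 1 else B.
have p0 : nonneg_job p by move=> i k; rewrite mxE; case: ifP.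
set hist' := hist ++ unzip1 (s1 ++ s2).
(* [o] is a finalist other than the choice [c] of the algorithm. *)
pose c := a hist' p; pose o := if c == i1 then i2 else i1.
pose s := (s1 ++ s2) ++ [:: (p, o)].
have oi : o \in [:: i1; i2] by rewrite /o; case: ifP; rewrite !inE eqxx ?orbT.
have so k : loads s1 o k + loads s2 o k = 0.
  by move: oi; rewrite !inE => /orP[]/eqP->;
    rewrite ?z1 ?z2 ?z1' ?z2' addr0.
have sE i k : loads s i k = loads s1 i k + loads s2 i k + (i == o)%:R.
  rewrite !loads_cat loads_cons loads_nil addr0 !mxE; congr (_ + _).
  by case: eqP => [->|//]; rewrite oi.
have runE i k : loads (run a hist (unzip1 s)) i k =
    loads (run a hist (unzip1 s1)) i k +
    loads (run a (hist ++ unzip1 s1) (unzip1 s2)) i k + place c p i k.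
  rewrite /unzip1 map_cat run_cat map_cat run_cat -!/(unzip1 _) !loads_cat.
  rewrite /= loads_cons loads_nil addr0 !mxE /= /c /hist'.
  by rewrite /unzip1 map_cat.
have Xi1 : i1 \in X.
  by have := X12 i1; rewrite i1X; case: (i1 \in X) => //; case: (i1 \in X2) => /=; lra.
have Xi2 : i2 \in X.
  by have := X12 i2; rewrite i2X; case: (i2 \in X) => //; case: (i2 \in X1) => /=; lra.
exists s; split.
- rewrite /unzip1 !map_cat; apply: (nn _ _ (nn _ _ s10 s20)).
  exact/nonneg_jobs_cons.
- move=> i k; rewrite sE; have [->|io] := eqVneq i o.
    rewrite so add0r; move: oi.
    by rewrite !inE => /orP[]/eqP->; rewrite ?Xi1 ?Xi2.
  by rewrite addr0 -X12 lerD.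
- have [ci|ci] := boolP (c \in [:: i1; i2]).
    have pc k : place c p c k = 1 by rewrite !mxE eqxx ci.
    right; exists c; split.
    + by move: ci; rewrite !inE => /orP[]/eqP->.
    + move=> k; rewrite sE (_ : (c == o) = false).
        by move: ci; rewrite !inE => /orP[]/eqP->; rewrite ?z1 ?z2 ?z1' ?z2' !addr0.
      by rewrite /o; case: (eqVneq c i1) => [->|ne]; exact: negPf.
    + move=> k; rewrite runE pc -natr1 lerD2r.
      move: ci; rewrite !inE => /orP[]/eqP ->.
        by rewrite ler_wpDr.
      by rewrite ler_wpDl.
  left; exists c, (Ordinal d0); rewrite runE !mxE eqxx (negPf ci).
  by rewrite ler_wpDl// addr_ge0.
Qed.

End Adversaries.

(** * From the adversaries to the competitive ratio *)

Section LowerBound.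
Context {R : realType} {m d : nat}.
Variables (A : online_algorithm R m d) (r alpha : R).
Hypothesis r1 : 1 <= r.
Hypothesis A_competitive : competitive A (fun=> r) (fun=> alpha).

Lemma Lr_norm_le_sum (x : 'I_m -> R) t : 0 <= t ->
  (forall i, 0 <= x i <= 1) -> \sum_i x i <= t `^ r -> Lr_norm r x <= t.
Proof.
move=> t0 x01 xt; rewrite Lr_norm_le//; apply: le_trans xt; apply: ler_sum => i _.
have /andP[] := x01 i; rewrite le_eqVlt => /predU1P[<- _|xi0 xi1].
  by rewrite powR0// gt_eqF// (lt_le_trans ltr01).
by rewrite ge1r_powR// xi0.
Qed.

Lemma competitive_load_le t s i k : nonneg_jobs (unzip1 s) -> 0 <= t ->
  (forall i k, loads s i k <= 1) -> (forall k, \sum_i loads s i k <= t `^ r) ->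
  loads (run (A (fun=> r) (fun=> t)) [::] (unzip1 s)) i k <= alpha * t.
Proof.
move=> s0 t0 s1 st; have /competitiveP H := A_competitive.
apply: le_trans (H (fun=> t) s s0 _ k).
  apply: (@le_Lr_norm _ _ r (fun i => loads (run _ [::] (unzip1 s)) i k)) => //.
  by apply: loads_ge0; rewrite unzip1_run.
by move=> k'; apply: Lr_norm_le_sum => // i'; rewrite loads_ge0/=.
Qed.

(** The factor 2 arises because the load [n] is only the total of two machines. Taking [B = n] makes
    a forbidden choice at least as costly. *)
Lemma lower_bound_dimensions n : (1 < m)%N -> (2 ^ n <= d)%N ->
  n%:R <= 2 * alpha.
Proof.
move=> m1 nd; pose i0 := Ordinal (ltnW m1); pose i1 := Ordinal m1.
have i01 : i0 != i1 by [].
have Su : uniq (take (2 ^ n) (enum 'I_d)) by rewrite take_uniq ?enum_uniq.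
have Ss : size (take (2 ^ n) (enum 'I_d)) = (2 ^ n)%N.
  by rewrite size_takel// size_enum_ord.
have [s [s0 sS alt]] := dimension_adversary (A (fun=> r) (fun=> 1))
  (ler0n R n) i01 [::] Su Ss.
have sum1 k : \sum_i loads s i k <= 1 by apply: le_trans (sS k) _; rewrite lern1 leq_b1.
have s1 i k : loads s i k <= 1.
  apply: le_trans (sum1 k); rewrite (bigD1 i)//= lerDl.
  by apply: sumr_ge0 => j _; apply: loads_ge0.
have H i k : loads (run (A (fun=> r) (fun=> 1)) [::] (unzip1 s)) i k <= alpha.
  by rewrite -[alpha]mulr1 competitive_load_le// => k'; rewrite powR1.
case: alt => [[i [k Bik]]|[k [_ nk]]].
  have na := le_trans Bik (H i k); apply: (le_trans na).
  by rewrite ler_peMl ?ler1n// (le_trans _ na).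
by apply: le_trans nk _; rewrite mulr_natl mulr2n lerD.
Qed.

(** The target 2 is feasible: offline loads are at most 1 and sum to at most [2 ^ n <= 2 ^ r] in
    each dimension. *)
Lemma lower_bound_norm n : (0 < d)%N -> (2 ^ n <= m)%N -> n%:R <= r ->
  n%:R <= 2 * alpha.
Proof.
move=> d0 nm nr.
have Xu : uniq (take (2 ^ n) (enum 'I_m)) by rewrite take_uniq ?enum_uniq.
have Xs : size (take (2 ^ n) (enum 'I_m)) = (2 ^ n)%N.
  by rewrite size_takel// size_enum_ord.
have [s [s0 sX alt]] := tournament_adversary (A (fun=> r) (fun=> 2))
  (ler0n R n) [::] Xu Xs d0.
have s1 i k : loads s i k <= 1 by apply: le_trans (sX i k) _; rewrite lern1 leq_b1.
have sum2 k : \sum_i loads s i k <= 2 `^ r.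
  apply: (@le_trans _ _ (2 ^ n)%:R).
    apply: le_trans (ler_sum _ (fun i _ => sX i k)) _.
    rewrite -natr_sum ler_nat -[leqRHS]Xs -(card_uniqP Xu) -sum1_card.
    by rewrite [leqRHS]big_mkcond/=; apply: leq_sum => i _; case: ifP.
  rewrite natrX -powR_mulrn//; apply: ler_powR => //.
  by rewrite ler1n.
rewrite mulrC; have H i k := competitive_load_le i k s0 (ler0n R 2) s1 sum2.
case: alt => [[i [k Bik]]|[i [_ _ ni]]]; first exact: le_trans Bik (H i k).
exact: le_trans (ni (Ordinal d0)) (H i _).
Qed.

(** Let [n >= 1] be the floor of [r]. Then [r <= n + 1 <= 2 * n <= 4 * alpha], and [log2 d <=
    trunc_log 2 d + 1 <= 2 * alpha + n <= 4 * alpha]. *)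
Lemma lower_bound : (0 < d)%N -> r <= log2 m%:R ->
  8^-1 * (r + log2 d%:R) <= alpha.
Proof.
move=> d0 rm; have r0 : 0 <= r by apply: le_trans r1.
have m0 : (0 < m)%N.
  (* By convention [ln 0 = 0], so [m = 0] would contradict [1 <= r]. *)
  rewrite lt0n; apply/eqP => m0; move: rm; rewrite m0 /log2 ln0// mul0r.
  by rewrite leNgt (lt_le_trans ltr01 r1).
have rle : 2 `^ r <= m%:R by rewrite powR2_le_log2// ltr0n.
have /andP[nr rn] := truncn_itv r0.
have nm : (2 ^ Num.truncn r <= m)%N.
  rewrite -(ler_nat R) natrX -powR_mulrn//; apply: le_trans rle.
  by rewrite ler_powR// ler1n.
have Hr := lower_bound_norm d0 nm nr.
have n1 : (1 <= Num.truncn r)%N by rewrite truncn_ge_nat// ltW.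
(* This provides the two machines of the dimension adversary. *)
have m1 : (1 < m)%N by apply: leq_trans nm; rewrite -{1}(expn1 2) leq_exp2l.
have Hd := lower_bound_dimensions m1 (trunc_logP (ltnSn 1) d0).
have Hlog : log2 (d%:R : R) <= (trunc_log 2 d)%:R + 1.
  rewrite natr1 leNgt; apply/negP => H.
  have := ltW H; rewrite -powR2_le_log2 ?ltr0n// powR_mulrn// -natrX ler_nat.
  by rewrite leqNgt trunc_log_ltn.
rewrite -natr1 in rn; have : 1 <= (Num.truncn r)%:R :> R by rewrite ler1n.
move: Hr Hd rn Hlog; lra.
Qed.

End LowerBound.

Theorem theorem4 (R : realType) :
  (exists C : R, 0 < C /\
     forall m d : nat, (0 < m)%N -> (0 < d)%N ->
     exists A : online_algorithm R m d,
     forall r : 'I_d -> R, admissible_norms m r ->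
       competitive A r (fun k => C * (r k + log2 d%:R)))
  /\
  (exists c : R, 0 < c /\
     forall (m d : nat) (r : R), (0 < m)%N -> (0 < d)%N ->
       1 <= r <= log2 m%:R ->
     forall (A : online_algorithm R m d) (alpha : R),
       competitive A (fun=> r) (fun=> alpha) ->
       c * (r + log2 d%:R) <= alpha).
Proof.
split.
  exists 18; split=> // m d m0 d0.
  exists (fun r T => greedy (Ordinal m0) (greedy_allowed T) (greedy_potential r T)).
  by move=> r rm; apply: greedy_competitive => // k; case/andP: (rm k).
exists 8^-1; split=> [|m d r _ d0 /andP[r1 rm] A alpha HA]; first by rewrite invr_gt0.
exact: lower_bound HA _ _.
Qed.
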